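(* Let $\mathbb{T}$ be a time scale, $a,b\in\mathbb{T}$ with $a<b$, $\alpha\in[0,1]$, and $f,g,h\in C([a,b]_{\mathbb{T}},[0,\infty))$ with $\int_a^bh(x)g^q(x)\Diamond_\alpha x>0$, where $q$ is the H\''older conjugate number of $p$, i.e. $\frac1p+\frac1q=1$ with $1<p$. Then $$\int_a^bh(x)f(x)g(x)\Diamond_\alpha x\le\left(\int_a^bh(x)f^p(x)\Diamond_\alpha x\right)^{\frac1p}\left(\int_a^bh(x)g^q(x)\Diamond_\alpha x\right)^{\frac1q}.$$
   Context: A time scale is a nonempty closed subset of $\mathbb{R}$; $[a,b]_{\mathbb{T}}=[a,b]\cap\mathbb{T}$; $\sigma(t)=\inf\{s\in\mathbb{T}:s>t\}$, $\rho(t)=\sup\{s\in\mathbb{T}:s<t\}$. The $\Delta$-derivative $f^\Delta(t)$ satisfies: for each $\varepsilon>0$, $|f(\sigma(t))-f(s)-f^\Delta(t)(\sigma(t)-s)|\le\varepsilon|\sigma(t)-s|$ for $s$ near $t$; the $\nabla$-derivative is defined likewise with $\rho$ in place of $\sigma$. $\int_a^bf\Delta t=F(b)-F(a)$ with $F^\Delta=f$, and $\int_a^bf\nabla t=H(b)-H(a)$ with $H^\nabla=f$. For $0\le\alpha\le1$ the $\Diamond_\alpha$-integral is $\int_a^bf(s)\Diamond_\alpha s=\alpha\int_a^bf(s)\Delta s+(1-\alpha)\int_a^bf(s)\nabla s$. $C(X,Y)$ denotes continuous functions. *)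

(* Defs.v *)
From HB Require Import structures.
From mathcomp Require Import all_boot all_order all_algebra.
From mathcomp Require Import all_classical all_reals all_analysis.

Set Implicit Arguments.
Unset Strict Implicit.
Unset Printing Implicit Defensive.

Import Order.TTheory GRing.Theory Num.Theory.
Import numFieldNormedType.Exports.

Local Open Scope classical_set_scope.
Local Open Scope ring_scope.

Section TimeScale.
Variable R : realType.
Implicit Types (T A Y : set R) (f F : R -> R) (a b t l alpha : R).

Definition time_scale T : Prop := closed T /\ T !=set0.

Definition ts_itv T a b : set R := `[a, b] `&` T.

(* The usual conventions inf set0 = sup T and sup set0 = inf T are built in,
   since the library's inf and sup return 0 on the empty set. They make
   sigma fix the maximum of T and rho fix its minimum. *)
Definition sigma T t : R :=
  let A := [set s | T s /\ t < s] in
  if `[< A !=set0 >] then inf A else sup T.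

Definition rho T t : R :=
  let A := [set s | T s /\ s < t] in
  if `[< A !=set0 >] then sup A else inf T.

Definition is_delta_derive T F t l : Prop :=
  forall e : R, 0 < e -> \forall s \near t, T s ->
    `|F (sigma T t) - F s - l * (sigma T t - s)| <= e * `|sigma T t - s|.

Definition is_nabla_derive T F t l : Prop :=
  forall e : R, 0 < e -> \forall s \near t, T s ->
    `|F (rho T t) - F s - l * (rho T t - s)| <= e * `|rho T t - s|.

(* Quantifying over all of T is the same as excluding a left-scattered maximum
   (resp. a right-scattered minimum), as is customary: at such a point every
   number is a delta (resp. nabla) derivative, so nothing is required. *)
Definition delta_antiderivative T f F : Prop :=
  forall t, T t -> is_delta_derive T F t (f t).

Definition nabla_antiderivative T f F : Prop :=
  forall t, T t -> is_nabla_derive T F t (f t).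

(* Integrals from a to b, for a <= b in T, of functions that matter only on
   [a, b] `&` T, which is regarded as a time scale in its own right. The junk
   value 0 is returned when there is no antiderivative. *)
Definition delta_int T f a b : R :=
  xget 0 [set v | exists2 F,
    delta_antiderivative (ts_itv T a b) f F & v = F b - F a].

Definition nabla_int T f a b : R :=
  xget 0 [set v | exists2 F,
    nabla_antiderivative (ts_itv T a b) f F & v = F b - F a].

Definition diamond_int alpha T f a b : R :=
  alpha * delta_int T f a b + (1 - alpha) * nabla_int T f a b.

(* Membership in C(A, Y), for a function given by a total extension. *)
Definition continuous_on_into A Y f : Prop :=
  {within A, continuous f} /\ (forall x, A x -> Y (f x)).

End TimeScale.

(* Main.v *)
Require Import Defs.
From HB Require Import structures.
From mathcomp Require Import all_boot all_order all_algebra.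
From mathcomp Require Import all_classical all_reals all_analysis.
From mathcomp Require Import measurable_realfun ring lra.

(** The diamond integral over [a, b] is a positive linear functional on the
    functions that are continuous on the part of the time scale between [a] and
    [b], and Hoelder's inequality holds for every such functional: apply it to
    Young's inequality for the normalized functions f / s and g / t, with s and t
    the two factors on the right-hand side ([hoelder_positive_linear]).

    The integral is defined through antiderivatives, so its linearity and
    positivity rest on two facts about a compact time scale.
    Uniqueness: an antiderivative of a nonnegative function does not decrease
    from end to end ([delta_nondecreasing]), by a supremum argument at the last
    point that has not fallen below the initial value.  Hence increments of
    antiderivatives are monotone in the integrand, in particular determined by it.
    Existence: a continuous function on the scale, extended over each gap by its
    value at the left end of the gap, is bounded and measurable on the line, and
    its Lebesgue integral is a delta antiderivative
    ([delta_antiderivative_exists]).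

    The nabla integral is the delta integral of the reflected function on the
    reflected scale ([nabla_int_reflection]), so it inherits these properties, and
    the diamond integral does as a convex combination of the two. *)

Set Implicit Arguments.
Unset Strict Implicit.
Unset Printing Implicit Defensive.

Import Order.TTheory GRing.Theory Num.Theory.
Import numFieldNormedType.Exports.

Local Open Scope classical_set_scope.
Local Open Scope ring_scope.

(** * Hoelder's inequality for positive linear functionals *)

(** Continuity for the subspace topology of [K], by [subspace_continuousP], in
    the form to which the limit theorems for filters apply directly. *)
Definition cont_on (R : realType) (K : set R) (f : R -> R) : Prop :=
  forall x, K x -> f @ within K (nbhs x) --> f x.

Definition positive_linear_on (R : realType) (K : set R)
    (I : (R -> R) -> R) : Prop :=
  (forall u v f g, cont_on K f -> cont_on K g ->
     I (fun x => u * f x + v * g x) = u * I f + v * I g) /\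
  (forall f g, cont_on K f -> cont_on K g ->
     (forall x, K x -> f x <= g x) -> I f <= I g).

Section Hoelder.
Variables (R : realType) (K : set R).
Implicit Types (f g h : R -> R) (p q s t : R).

Lemma cont_onM f g : cont_on K f -> cont_on K g ->
  cont_on K (fun x => f x * g x).
Proof.
by move=> cf cg x Kx; apply: cvgM; [exact: cf|exact: cg].
Qed.

Lemma cont_onD u v f g : cont_on K f -> cont_on K g ->
  cont_on K (fun x => u * f x + v * g x).
Proof.
move=> cf cg x Kx.
by apply: cvgD; apply: cvgMl_tmp; [exact: cf|exact: cg].
Qed.

Lemma cont_on_powR f q : 0 < q -> (forall x, K x -> 0 <= f x) ->
  cont_on K f -> cont_on K (fun x => f x `^ q).
Proof.
move=> q0 f0 cf t Kt.
have ft := cf t Kt; have := f0 t Kt; rewrite le_eqVlt => /orP[/eqP f0t|ftp].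
  (* The real power jumps at 0 from the left, so only nonnegative values may be
     used here. *)
  rewrite /= -f0t powR0 ?gt_eqF //; apply/cvgr0Pnorm_le => e e0.
  have e'0 : 0 < e `^ q^-1 by exact: powR_gt0.
  near=> s.
  have Ks : K s by near: s; exact: withinT.
  have : `|f t - f s| <= e `^ q^-1.
    by near: s; exact: cvgr_dist_le ft _ e'0.
  rewrite -f0t sub0r normrN (ger0_norm (f0 _ Ks)) => fe.
  rewrite ger0_norm ?powR_ge0 //.
  have <- : (e `^ q^-1) `^ q = e.
    by rewrite -powRrM mulVf ?gt_eqF // powRr1 // ltW.
  by apply: ge0_ler_powR => //; rewrite ?nnegrE ?f0 // ltW.
have dq : derivable (fun x : R => x `^ q : R) (f t) (1 : R).
  by apply: derivable_powR; rewrite in_itv /= ftp.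
have cq : {for f t, continuous (fun x : R => x `^ q : R)}.
  by apply: differentiable_continuous; exact/derivable1_diffP.
exact: (cvg_comp _ _ ft cq).
Unshelve. all: by end_near. Qed.

(** Young's inequality for [y / s] and [z / t], multiplied by [w * s * t]. *)
Lemma weighted_young p q s t (y z w : R) : 0 < p -> 0 < q ->
  p^-1 + q^-1 = 1 -> 0 < s -> 0 < t -> 0 <= y -> 0 <= z -> 0 <= w ->
  w * y * z <= s * t / (p * s `^ p) * (w * y `^ p)
             + s * t / (q * t `^ q) * (w * z `^ q).
Proof.
move=> p0 q0 pq s0 t0 y0 z0 w0.
have si : 0 <= s^-1 by rewrite invr_ge0 ltW.
have ti : 0 <= t^-1 by rewrite invr_ge0 ltW.
have := conjugate_powR (mulr_ge0 y0 si) (mulr_ge0 z0 ti) p0 q0 pq.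
have sti : 0 <= w * (s * t) by rewrite !mulr_ge0 // ltW.
move=> /(ler_wpM2l sti).
have powRV x r : 0 < x -> (x^-1) `^ r = (x `^ r)^-1.
  by move=> x0; rewrite -(powR_inv1 (ltW x0)) -powRrM mulN1r powRN.
rewrite !powRM // !powRV //.
have sp := lt0r_neq0 (powR_gt0 p s0); have tq := lt0r_neq0 (powR_gt0 q t0).
rewrite [X in X <= _ -> _](_ : _ = w * y * z); last by field; rewrite !gt_eqF.
move=> /le_trans; apply; rewrite le_eqVlt; apply/orP; left; apply/eqP.
by field; rewrite sp tq !gt_eqF.
Qed.

(** Apply [I] to the weighted Young inequality, with [s] and [t] equal to the two
    factors on the right-hand side; the bound is then [s * t].  If the factor of
    [f] vanishes, every positive [s] is admissible and can tend to 0. *)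
Lemma hoelder_positive_linear (I : (R -> R) -> R) p q f g h :
  positive_linear_on K I -> 1 < p -> p^-1 + q^-1 = 1 ->
  cont_on K f -> cont_on K g -> cont_on K h ->
  (forall x, K x -> 0 <= f x) -> (forall x, K x -> 0 <= g x) ->
  (forall x, K x -> 0 <= h x) ->
  0 < I (fun x => h x * g x `^ q) ->
  I (fun x => h x * f x * g x) <=
    I (fun x => h x * f x `^ p) `^ p^-1 * I (fun x => h x * g x `^ q) `^ q^-1.
Proof.
move=> [Ilin Imono] p1 pq cf cg ch f0 g0 h0.
have p0 : 0 < p by lra.
have q0 : 0 < q.
  by rewrite -invr_gt0; have : p^-1 < 1 by [rewrite invf_lt1]; lra.
set B := I (fun x => h x * g x `^ q); set A := I (fun x => h x * f x `^ p).
move=> B0.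
have chf := cont_onM ch (cont_on_powR p0 f0 cf).
have chg := cont_onM ch (cont_on_powR q0 g0 cg).
have A0 : 0 <= A.
  have I0 : I (fun x => 0 * h x + 0 * h x) = 0 by rewrite Ilin // !mul0r addr0.
  rewrite -I0; apply: Imono => // [|x Kx]; first exact: cont_onD.
  by rewrite !mul0r addr0 mulr_ge0 ?powR_ge0 ?h0.
set t := B `^ q^-1.
have t0 : 0 < t by exact: powR_gt0.
have tq : t `^ q = B by rewrite -powRrM mulVf ?gt_eqF // powRr1 // ltW.
have bound s : 0 < s -> A <= s `^ p -> I (fun x => h x * f x * g x) <= s * t.
  move=> s0 As; have sp0 := powR_gt0 p s0.
  apply: le_trans (Imono _ (fun x =>
    s * t / (p * s `^ p) * (h x * f x `^ p)
    + s * t / (q * t `^ q) * (h x * g x `^ q)) _ _ _) _.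
  - by apply: cont_onM => //; exact: cont_onM.
  - exact: cont_onD.
  - by move=> x Kx; apply: weighted_young; rewrite ?f0 ?g0 ?h0.
  rewrite Ilin // -/A -/B tq.
  have -> : s * t / (q * B) * B = s * t * q^-1 by field; rewrite !gt_eqF.
  rewrite -[leRHS]mulr1 -pq mulrDr lerD2r -!mulrA ler_wpM2l ?(ltW s0) //.
  rewrite ler_wpM2l ?(ltW t0) // invfM -mulrA ler_piMr ?invr_ge0 ?(ltW p0) //.
  by rewrite mulrC ler_pdivrMr // mul1r.
move: A0; rewrite le_eqVlt => /orP[/eqP A0|A0]; last first.
  have As : (A `^ p^-1) `^ p = A.
    by rewrite -powRrM mulVf ?gt_eqF // powRr1 // ltW.
  by apply: bound; [exact: powR_gt0|rewrite As].
rewrite -A0 powR0 ?invr_neq0 ?gt_eqF // mul0r.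
apply/ler_addgt0Pr => e e0; rewrite add0r -(divfK (lt0r_neq0 t0) e).
by apply: bound; rewrite ?divr_gt0 // -A0 powR_ge0.
Qed.

End Hoelder.

(** * Compact time scales and the forward jump *)

(** The abstract form of the part of a time scale between two of its points:
    compactness, with the extreme points named. *)
Definition compact_scale (R : realType) (K : set R) (a b : R) : Prop :=
  [/\ closed K, K a, K b & forall x, K x -> a <= x <= b].

Section ForwardJump.
Variables (R : realType) (K : set R) (a b : R).
Hypothesis hK : compact_scale K a b.
Implicit Types (s t x : R) (S : set R).

Lemma scale_sup S : S `<=` K -> S !=set0 ->
  K (sup S) /\ (forall s, S s -> s <= sup S).
Proof.
move=> SK S0; case: hK => cK _ _ Kab.
have ubS : has_ubound S by exists b => s /SK /Kab /andP[].
split; last by move=> s Ss; exact: ub_le_sup.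
apply: cK; apply: (closure_subset SK).
exact: closure_sup.
Qed.

Lemma scale_inf S : S `<=` K -> S !=set0 ->
  K (inf S) /\ (forall s, S s -> inf S <= s).
Proof.
move=> SK S0; case: hK => cK _ _ Kab.
have lbS : has_lbound S by exists a => s /SK /Kab /andP[].
split; last by move=> s Ss; exact: ge_inf.
apply: cK; apply: (closure_subset SK).
move=> B /nbhs_ballP[e /= e0 eB].
have [s Ss se] := inf_adherent e0 (conj S0 lbS).
exists s; split=> //; apply: eB; rewrite -ball_normE /= ltr_norml.
by have := ge_inf lbS Ss; lra.
Qed.

Lemma sup_scale : sup K = b.
Proof.
case: hK => _ _ Kb Kab; apply/eqP; rewrite eq_le; apply/andP; split.
  by apply: ge_sup => [|x /Kab /andP[]]; [exists b|].
by apply: ub_le_sup => //; exists b => x /Kab /andP[].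
Qed.

Lemma sigma_in t : K t -> K (sigma K t).
Proof.
move=> Kt; rewrite /sigma; case: asboolP => [S0|_].
  by apply: (scale_inf _ S0).1 => s [].
by rewrite sup_scale; case: hK.
Qed.

Lemma sigma_ge t : K t -> t <= sigma K t.
Proof.
move=> Kt; rewrite /sigma; case: asboolP => [S0|_].
  by apply: lb_le_inf => // s [_ /ltW].
by rewrite sup_scale; case: hK => _ _ _ /(_ _ Kt) /andP[].
Qed.

Lemma sigma_le t s : K s -> t < s -> sigma K t <= s.
Proof.
move=> Ks ts; rewrite /sigma; case: asboolP => [S0|[]]; last by exists s.
by apply: (scale_inf _ S0).2 => // x [].
Qed.

Lemma right_dense_point t e : t < b -> sigma K t = t -> 0 < e ->
  exists2 s, K s & t < s < t + e.
Proof.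
move=> tb st e0; case: hK => _ _ Kb Kab.
have S0 : [set s | K s /\ t < s] !=set0 by exists b.
have [|s [Ks ts] se] := @inf_adherent R [set s | K s /\ t < s] e e0.
  by split=> //; exists a => s [/Kab /andP[]].
exists s => //; rewrite ts /=.
by move: st; rewrite /sigma; case: asboolP => // _ <-.
Qed.

(** * Monotonicity of antiderivatives *)

(** Whatever the jump of [t], comparing the defining inequality at [s] with the
    one at [t] itself eliminates the value at [sigma t] and bounds the increment
    from [s] to [t]. *)
Lemma delta_derive_continuous F t l e : K t -> is_delta_derive K F t l ->
  0 < e -> \forall s \near t, K s -> `|F t - F s| <= e.
Proof.
move=> Kt dF e0; set d := sigma K t - t.
have d0 : 0 <= d by rewrite subr_ge0; exact: sigma_ge.
pose e1 := e / (2 * (2 * d + 1)).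
have e1E : e1 * (2 * d + 1) = e / 2 by rewrite /e1; field; lra.
have e10 : 0 < e1 by apply: divr_gt0 => //; lra.
have dt : `|F (sigma K t) - F t - l * d| <= e1 * d.
  by move: (nbhs_singleton (dF _ e10) Kt); rewrite -/d (ger0_norm d0).
pose m := `|l| + e1 + 1.
have m0 : 0 < m by have := normr_ge0 l; rewrite /m; lra.
near=> s => Ks.
have ds : `|F (sigma K t) - F s - l * (sigma K t - s)|
    <= e1 * `|sigma K t - s|.
  by move: Ks; near: s; exact: dF.
have ts : `|t - s| <= e / (2 * m).
  near: s; apply: cvgr_dist_le; first exact: cvg_id.
  by apply: divr_gt0 => //; lra.
have tm : (`|l| + e1) * `|t - s| <= e / 2.
  have <- : m * (e / (2 * m)) = e / 2 by field; lra.
  by apply: ler_pM => //; have := normr_ge0 l; rewrite /m; lra.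
have ss : `|sigma K t - s| <= d + `|t - s|.
  have -> : sigma K t - s = d + (t - s) by rewrite /d; ring.
  by apply: le_trans (ler_normD _ _) _; rewrite (ger0_norm d0).
have -> : F t - F s = (F (sigma K t) - F s - l * (sigma K t - s))
    - (F (sigma K t) - F t - l * d) + l * (t - s) by rewrite /d; ring.
apply: le_trans (ler_normD _ _) _; rewrite normrM.
apply: le_trans (lerD (ler_normB _ _) (lexx _)) _.
have := ler_wpM2l (ltW e10) ss.
by nra.
Unshelve. all: by end_near. Qed.


(** If [F b < F a], look at the last point [c] of the scale where [F] is still
    at least [F a].  A scattered [c] jumps to a point with a larger value, and a
    right-dense [c] has later points where [F] has not decreased. *)
Lemma delta_increasing f F : delta_antiderivative K f F ->
  (forall x, K x -> 0 < f x) -> F a <= F b.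
Proof.
move=> dF f0; case: (hK) => _ Ka Kb Kab.
rewrite leNgt; apply/negP => Fba.
pose S := [set t | K t /\ F a <= F t].
have SK : S `<=` K by move=> t [].
have S0 : S !=set0 by exists a; split.
have [Kc cub] := scale_sup SK S0; set c := sup S in Kc cub *.
have Fc : F a <= F c.
  rewrite leNgt; apply/negP => Fca.
  have e0 : 0 < (F a - F c) / 2 by lra.
  have /nbhs_ballP[d /= d0 dP] := delta_derive_continuous Kc (dF _ Kc) e0.
  have [|s [Ks Fs] cs] := @sup_adherent R S d d0.
    by split=> //; exists b => t [/Kab /andP[]].
  have bs : ball c d s.
    rewrite -ball_normE /= ltr_norml.
    by have := cub s (conj Ks Fs); rewrite -/c in cs; lra.
  by have := dP s bs Ks; rewrite ler_norml; lra.
have cb : c < b.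
  have /andP[_] := Kab _ Kc; rewrite le_eqVlt => /orP[/eqP cb|//].
  by move: Fc; rewrite cb leNgt Fba.
have fc := f0 _ Kc; have := sigma_ge Kc; rewrite le_eqVlt => /orP[/eqP cE|clt].
  have /nbhs_ballP[d /= d0 dP] := dF _ Kc _ fc.
  have [s Ks /andP[cs sd]] := right_dense_point cb (esym cE) d0.
  have bs : ball c d s by rewrite -ball_normE /= ltr_norml; lra.
  have := dP s bs Ks; rewrite -cE.
  rewrite (ltr0_norm (_ : c - s < 0)) ?subr_lt0 // ler_norml => /andP[_ Fs].
  have /cub : S s by split=> //; nra.
  by rewrite leNgt cs.
have dc0 : 0 < f c * (sigma K c - c) by apply: mulr_gt0 => //; lra.
have : `|F (sigma K c) - F c - f c * (sigma K c - c)|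
    <= f c / 2 * `|sigma K c - c|.
  by apply: (nbhs_singleton (dF _ Kc _ _)) => //; lra.
rewrite (gtr0_norm (_ : 0 < sigma K c - c)) ?subr_gt0 // ler_norml.
move=> /andP[Fs _].
have /cub : S (sigma K c) by split; [exact: sigma_in|nra].
by rewrite leNgt clt.
Qed.

Lemma delta_antiderivativeD u v f g F G :
  delta_antiderivative K f F -> delta_antiderivative K g G ->
  delta_antiderivative K (fun x => u * f x + v * g x)
    (fun x => u * F x + v * G x).
Proof.
move=> dF dG t Kt e e0.
pose m := `|u| + `|v| + 1.
have m0 : 0 < m by have := normr_ge0 u; have := normr_ge0 v; rewrite /m; lra.
have em : 0 < e / m by exact: divr_gt0.
near=> s => Ks.
have Fs : `|F (sigma K t) - F s - f t * (sigma K t - s)|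
    <= e / m * `|sigma K t - s|.
  by move: Ks; near: s; exact: dF.
have Gs : `|G (sigma K t) - G s - g t * (sigma K t - s)|
    <= e / m * `|sigma K t - s|.
  by move: Ks; near: s; exact: dG.
rewrite [X in `|X|](_ : _ = u * (F (sigma K t) - F s - f t * (sigma K t - s))
    + v * (G (sigma K t) - G s - g t * (sigma K t - s))); last by ring.
apply: le_trans (ler_normD _ _) _; rewrite !normrM.
apply: le_trans (lerD (ler_wpM2l (normr_ge0 u) Fs)
  (ler_wpM2l (normr_ge0 v) Gs)) _.
have uvm : (`|u| + `|v|) * (e / m) <= e.
  by rewrite mulrCA ger_pMr // ler_pdivrMr // mul1r /m; lra.
have := ler_wpM2r (normr_ge0 (sigma K t - s)) uvm.
by move=> /(le_trans _); apply; rewrite !mulrDl !mulrA.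
Unshelve. all: by end_near. Qed.

Lemma delta_antiderivative_id : delta_antiderivative K (fun=> 1) id.
Proof.
move=> t Kt e e0; near=> s => Ks.
by rewrite mul1r subrr normr0 mulr_ge0 // ltW.
Unshelve. all: by end_near. Qed.

(** Adding a small multiple of the identity to [F] makes the derivative
    positive, and the multiple can be made to vanish. *)
Lemma delta_nondecreasing f F : delta_antiderivative K f F ->
  (forall x, K x -> 0 <= f x) -> F a <= F b.
Proof.
move=> dF f0; case: (hK) => _ Ka Kb Kab.
have /andP[_ ab] := Kab _ Ka.
apply/ler_addgt0Pr => e e0.
have d0 : 0 < e / (b - a + 1) by apply: divr_gt0 => //; lra.
have := delta_increasing (delta_antiderivativeD 1 (e / (b - a + 1)) dF
  delta_antiderivative_id) _.
rewrite !mul1r => h.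
have {}h := h (fun x Kx => ltac:(rewrite !mulr1; have := f0 x Kx; lra)).
have : e / (b - a + 1) * (b - a) <= e.
  by rewrite mulrAC ler_pdivrMr ?ler_wpM2l ?ltW //; lra.
by nra.
Qed.

(** Applied to [F] and [G] in both orders with [f = g], this also shows that the
    increment of an antiderivative depends only on the integrand. *)
Lemma delta_antiderivative_le f g F G :
  delta_antiderivative K f F -> delta_antiderivative K g G ->
  (forall x, K x -> f x <= g x) -> F b - F a <= G b - G a.
Proof.
move=> dF dG fg.
have := delta_nondecreasing (delta_antiderivativeD 1 (-1) dG dF) _.
move=> /(_ (fun x Kx => ltac:(have := fg x Kx; lra))).
by lra.
Qed.

End ForwardJump.

(** * Existence of antiderivatives *)

Section Integral.
Variable R : realType.
Local Notation mu := (@lebesgue_measure R).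
Implicit Types (phi : R -> R) (a x y c e M : R).

Lemma bounded_integrable phi (i : interval R) M : measurable_fun setT phi ->
  (forall x, `|phi x| <= M) -> (mu [set` i] < +oo)%E ->
  mu.-integrable [set` i] (EFin \o phi).
Proof.
move=> mphi phiM ifin; apply: measurable_bounded_integrable => //.
  exact: measurable_funTS.
exists M; split=> [|N MN x _ /=]; first exact: num_real.
exact/(le_trans (phiM x))/ltW.
Qed.

(** This replaces the fundamental theorem of calculus: a time scale only needs
    increments over intervals on which the integrand is nearly constant, and
    these may be long when they span a gap.  The right end is excluded because
    the integrand may jump there, at the end of a gap. *)
Lemma Rintegral_increment phi a x y c e M : measurable_fun setT phi ->
  (forall z, `|phi z| <= M) -> a <= x -> x <= y ->
  (forall z, x <= z -> z < y -> `|phi z - c| <= e) ->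
  `| \int[mu]_(z in `[a, y[) phi z - \int[mu]_(z in `[a, x[) phi z
     - c * (y - x)| <= e * (y - x).
Proof.
move=> mphi phiM ax xy phic.
have ifin u v : (mu [set` Interval (BLeft u) (BLeft v)] < +oo)%E.
  by rewrite lebesgue_measure_itv /=; case: ifP => // _; rewrite -EFinB ltry.
have len : fine (mu [set` `[x, y[]) = y - x.
  rewrite lebesgue_measure_itv /= lte_fin.
  by move: xy; rewrite le_eqVlt => /orP[/eqP ->|->]; rewrite ?ltxx ?subrr.
have intphi u v := bounded_integrable mphi phiM (ifin u v).
have intc (d : R) : mu.-integrable `[x, y[ (EFin \o (fun=> d)).
  by apply: (@bounded_integrable _ _ `|d|).
have -> : \int[mu]_(z in `[a, y[) phi z =
    \int[mu]_(z in `[a, x[) phi z + \int[mu]_(z in `[x, y[) phi z.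
  rewrite (@itv_bndbnd_setU _ _ (BLeft a) (BLeft x) (BLeft y)) ?bnd_simp //.
  rewrite Rintegral_setU //.
    by rewrite -itv_bndbnd_setU ?bnd_simp.
  apply/disj_setPS => z [] /=; rewrite !in_itv /=.
  by move=> /andP[_ zx] /andP[xz _]; move: (le_lt_trans xz zx); rewrite ltxx.
rewrite [X in X - c * _]addrAC subrr add0r.
have -> : c * (y - x) = \int[mu]_(z in `[x, y[) c by rewrite Rintegral_cst ?len.
rewrite -RintegralB //.
have intd : mu.-integrable `[x, y[ (EFin \o (fun z => phi z - c)).
  apply: (@bounded_integrable _ _ (M + `|c|)) => //.
    exact: measurable_funB.
  by move=> z; apply: le_trans (ler_normB _ _) _; rewrite lerD2r.
apply: le_trans (le_normr_Rintegral _ intd) _ => //.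
rewrite -len -Rintegral_cst //; apply: le_Rintegral => //.
  exact: integrable_norm.
by move=> z /=; rewrite in_itv /= => /andP[]; exact: phic.
Qed.

End Integral.

Section Existence.
Variables (R : realType) (K : set R) (a b : R).
Hypothesis hK : compact_scale K a b.
Implicit Types (s t x : R) (f : R -> R).

(** The maximum with [a] keeps the set nonempty, so that the map is monotone on
    the whole line and not only to the right of [a]. *)
Let left_point x : R := sup [set s | K s /\ s <= Num.max a x].

Let left_pointP x : [/\ K (left_point x), left_point x <= Num.max a x &
  forall s, K s -> s <= Num.max a x -> s <= left_point x].
Proof.
case: (hK) => _ Ka _ _.
have S0 : [set s | K s /\ s <= Num.max a x] !=set0.
  by exists a; split; rewrite // le_max lexx.
have [Kl lub] := @scale_sup _ _ _ _ hK _ (fun s => @proj1 _ _) S0.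
split=> //; first by apply: ge_sup => // s [].
by move=> s Ks sx; apply: lub.
Qed.

Let left_point_nondecreasing : nondecreasing_fun left_point.
Proof.
move=> x y xy; have [Kx lx _] := left_pointP x.
have [_ _] := left_pointP y; apply=> //.
by apply: le_trans lx _; rewrite ge_max !le_max lexx xy orbT.
Qed.

(** The delta integral gives a gap of the scale the value at its left end, so
    the Lebesgue integral of [f \o left_point] is an antiderivative.  The
    composite is measurable because [left_point] is monotone.  For [s] near [t]
    and [z] between [s] and [sigma t], the point [left_point z] lies between [s]
    and [t], where [f] is close to [f t]. *)
Lemma delta_antiderivative_exists f :
  {within K, continuous f} -> exists F, delta_antiderivative K f F.
Proof.
move=> cf; case: (hK) => cK Ka Kb Kab.
have compK : compact K.
  apply: (subclosed_compact cK (@segment_compact _ a b)) => x /Kab.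
  by rewrite /= in_itv.
have [M fM] : exists M, forall x, K x -> `|f x| <= M.
  have [M [_ MP]] := compact_bounded (continuous_compact cf compK).
  by exists (M + 1) => x Kx; apply: MP; [rewrite ltrDl|exists x].
pose phi := (f \_ K) \o left_point.
have phiE z : phi z = f (left_point z).
  by rewrite /phi /= patchE mem_set //; have [] := left_pointP z.
have phiM z : `|phi z| <= M by rewrite phiE; apply: fM; have [] := left_pointP z.
have mphi : measurable_fun setT phi.
  have mK := closed_measurable cK.
  apply: measurableT_comp; last first.
    exact: (nondecreasing_measurable measurableT left_point_nondecreasing).
  apply/(measurable_restrictT _ mK).
  exact: (subspace_continuous_measurable_fun mK cf).
exists (fun t => \int[@lebesgue_measure R]_(z in `[a, t[) phi z).
move=> t Kt e e0.
have /andP[at_ tb] := Kab _ Kt.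
have /subspace_continuousP/(_ t Kt)/cvgr_dist_le/(_ e e0) := cf.
rewrite near_withinE => /nbhs_ballP[d /= d0 dP].
have near_f z : K z -> `|t - z| < d -> `|f z - f t| <= e.
  by move=> Kz zd; rewrite distrC; apply: dP => //; rewrite -ball_normE.
have between s z : K s -> a <= z -> s <= z -> s <= left_point z <= z.
  move=> Ks az sz; have [_ lz ls] := left_pointP z.
  by rewrite (max_idPr az) in lz ls; rewrite lz ls.
have near_phi s z : K s -> `|t - s| < d -> s <= t -> s <= z -> z < sigma K t ->
    `|phi z - f t| <= e.
  move=> Ks sd st sz zt; rewrite phiE; have [Kl _ _] := left_pointP z.
  have /andP[as_ _] := Kab _ Ks.
  have /andP[sl lz] := between _ _ Ks (le_trans as_ sz) sz.
  have lt : left_point z <= t.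
    rewrite leNgt; apply/negP => /(sigma_le hK Kl) h.
    by have := le_lt_trans (le_trans h lz) zt; rewrite ltxx.
  by apply: near_f => //; move: sd; rewrite !ger0_norm ?subr_ge0 //; lra.
have near_phi_right s z : K s -> `|t - s| < d -> t <= z -> z < s ->
    `|phi z - f t| <= e.
  move=> Ks sd tz zs; rewrite phiE; have [Kl _ _] := left_pointP z.
  have /andP[tl lz] := between _ _ Kt (le_trans at_ tz) tz.
  apply: near_f => //; move: sd; rewrite !ler0_norm ?subr_le0 //; lra.
have := sigma_ge hK Kt.
rewrite le_eqVlt => /orP[/eqP tE|lt_tsig].
  apply/nbhs_ballP; exists d => //= s; rewrite -ball_normE /= => sd Ks.
  rewrite -tE; have /andP[as_ sb] := Kab _ Ks.
  have [le_st|/ltW le_ts] := leP s t.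
    rewrite (ger0_norm (_ : 0 <= t - s)) ?subr_ge0 //.
    apply: (Rintegral_increment mphi phiM) => // z sz zt.
    by apply: near_phi Ks sd _ _ _; rewrite -?tE // ltW.
  rewrite (ler0_norm (_ : t - s <= 0)) ?subr_le0 // opprB -normrN.
  rewrite [X in `|X|](_ : _ = \int[@lebesgue_measure R]_(z in `[a, s[) phi z
    - \int[@lebesgue_measure R]_(z in `[a, t[) phi z - f t * (s - t));
    last by ring.
  apply: (Rintegral_increment mphi phiM) => // z tz zs.
  exact: near_phi_right Ks sd _ _.
(* To the right of a scattered point there is nothing to check: the ball is taken
   too small to reach the other end of the gap. *)
apply/nbhs_ballP; exists (Num.min d (sigma K t - t)) => /=.
  by rewrite lt_min d0 subr_gt0.
move=> s; rewrite -ball_normE /= lt_min => /andP[sd sg] Ks.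
have /andP[as_ sb] := Kab _ Ks.
have le_st : s <= t.
  rewrite leNgt; apply/negP => lt_ts; have := sigma_le hK Ks lt_ts.
  by move: sg; rewrite ltr0_norm ?subr_lt0 //; lra.
have ssig : s <= sigma K t by exact: le_trans le_st (ltW lt_tsig).
rewrite (ger0_norm (_ : 0 <= sigma K t - s)) ?subr_ge0 //.
apply: (Rintegral_increment mphi phiM) => // z sz zt.
exact: near_phi Ks sd _ _ _.
Qed.

End Existence.

(** * The integrals on a time scale as positive linear functionals *)

Section Functionals.
Variable R : realType.
Implicit Types (T K A : set R) (f F : R -> R) (a b t l alpha : R).

Lemma compact_scale_itv T a b : closed T -> T a -> T b -> a < b ->
  compact_scale (ts_itv T a b) a b.
Proof.
move=> cT Ta Tb ab; split.
- by apply: closedI => //; exact: itv_closed.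
- by split=> //; rewrite /= in_itv /= lexx ltW.
- by split=> //; rewrite /= in_itv /= lexx ltW.
- by move=> x []; rewrite /= in_itv.
Qed.

(** The value chosen in the definition of the integral is that of any
    antiderivative, since two of them have the same increment. *)
Lemma delta_intE T a b f F : compact_scale (ts_itv T a b) a b ->
  delta_antiderivative (ts_itv T a b) f F -> delta_int T f a b = F b - F a.
Proof.
move=> hK dF; rewrite /delta_int.
have [G dG ->] := @xgetPex _ 0 [set v | exists2 F,
  delta_antiderivative (ts_itv T a b) f F & v = F b - F a]
  (ex_intro _ _ (ex_intro2 _ _ F dF erefl)).
apply/eqP; rewrite eq_le.
by rewrite (delta_antiderivative_le hK dG dF) //
  (delta_antiderivative_le hK dF dG).
Qed.

Lemma delta_int_positive_linear T a b : closed T -> T a -> T b -> a < b ->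
  positive_linear_on (ts_itv T a b) (fun f => delta_int T f a b).
Proof.
move=> cT Ta Tb ab; have hK := compact_scale_itv cT Ta Tb ab.
have ex f : cont_on (ts_itv T a b) f ->
    exists F, delta_antiderivative (ts_itv T a b) f F.
  move=> cf; apply: (delta_antiderivative_exists hK).
  exact/subspace_continuousP.
split=> [u v f g /ex[F dF] /ex[G dG]|f g /ex[F dF] /ex[G dG] fg].
  rewrite (delta_intE hK dF) (delta_intE hK dG).
  by rewrite (delta_intE hK (delta_antiderivativeD u v dF dG)); ring.
rewrite (delta_intE hK dF) (delta_intE hK dG).
exact: (delta_antiderivative_le hK dF dG).
Qed.

Definition reflection A : set R := [set x | A (- x)].

Lemma image_reflection A : [set - x | x in reflection A] = A.
Proof.
apply/seteqP; split=> [_ [x Ax <-] //|x Ax].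
by exists (- x); rewrite /reflection /= opprK.
Qed.

Lemma inf_reflection A : inf (reflection A) = - sup A.
Proof. by rewrite /inf image_reflection. Qed.

Lemma reflectionK A : reflection (reflection A) = A.
Proof. by apply/seteqP; split=> x; rewrite /reflection /= opprK. Qed.

Lemma sup_reflection A : sup (reflection A) = - inf A.
Proof. by rewrite -{2}(reflectionK A) inf_reflection opprK. Qed.

Lemma sigma_reflection K t : sigma (reflection K) (- t) = - rho K t.
Proof.
rewrite /sigma /rho.
have -> : [set s | reflection K s /\ - t < s] =
    reflection [set s | K s /\ s < t].
  by apply/seteqP; split=> s /=; rewrite /reflection /= ltrNl.
set A := [set s | _]; case: asboolP => [[s As]|A0]; case: asboolP => // A1.
- exact: inf_reflection.
- by case: A1; exists (- s).
- by case: A0; case: A1 => s As; exists (- s); rewrite /reflection /= opprK.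
- exact: sup_reflection.
Qed.

Lemma nabla_derive_reflection K F t l : is_nabla_derive K F t l <->
  is_delta_derive (reflection K) (fun x => - F (- x)) (- t) l.
Proof.
have absN (u v : R) : u = - v -> `|u| = `|v| by move=> ->; exact: normrN.
rewrite /is_nabla_derive /is_delta_derive sigma_reflection opprK.
split=> dF e e0; apply/nbhs_ballP;
  have /nbhs_ballP[d /= d0 dP] := dF e e0; exists d => // s;
  rewrite -ball_normE /= => sd Ks.
- have bs : ball t d (- s).
    by rewrite -ball_normE /= (absN _ (- t - s)) //; ring.
  rewrite [X in X <= _](absN _ (F (rho K t) - F (- s) - l * (rho K t - - s)));
    last by ring.
  rewrite [X in _ <= _ * X](absN _ (rho K t - - s)); last by ring.
  exact: dP _ bs Ks.
- have bs : ball (- t) d (- s).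
    by rewrite -ball_normE /= (absN _ (t - s)) //; ring.
  have := dP _ bs; rewrite /reflection /= !opprK => /(_ Ks).
  rewrite [X in X <= _](absN _ (F (rho K t) - F s - l * (rho K t - s)));
    last by ring.
  by rewrite [X in _ <= _ * X](absN _ (rho K t - s)); last by ring.
Qed.

Lemma ts_itv_reflection T a b :
  ts_itv (reflection T) (- b) (- a) = reflection (ts_itv T a b).
Proof.
apply/seteqP; split=> x [] /=; rewrite !in_itv /= => /andP[xa xb] Tx.
  by split=> //=; rewrite in_itv /= lerNr xb lerNl xa.
by split=> //=; rewrite in_itv /= lerNl xb lerNr xa.
Qed.

(** Reflecting the line exchanges the two jumps and turns an antiderivative [F]
    into [fun x => - F (- x)], which has the same increment from end to end. *)
Lemma nabla_int_reflection T f a b :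
  nabla_int T f a b = delta_int (reflection T) (f \o -%R) (- b) (- a).
Proof.
rewrite /nabla_int /delta_int ts_itv_reflection; congr (xget 0 _).
apply/seteqP; split=> v [F dF ->].
  exists (fun x => - F (- x)); last by rewrite !opprK; ring.
  move=> t Kt /=; rewrite -[X in is_delta_derive _ _ X](opprK t).
  exact/nabla_derive_reflection/dF.
exists (fun x => - F (- x)); last by ring.
move=> t Kt; apply/nabla_derive_reflection.
have -> : (fun x => - - F (- - x)) = F by apply/funext => x; rewrite !opprK.
by rewrite -{2}(opprK t); apply: dF; rewrite /reflection /= opprK.
Qed.

Lemma cont_on_reflection K f :
  cont_on K f -> cont_on (reflection K) (f \o -%R).
Proof.
move=> cf t Kt; apply/cvgrPdist_le => e e0.
have /cvgr_dist_le/(_ e e0) := cf _ Kt.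
rewrite !near_withinE => /nbhs_ballP[d /= d0 dP].
apply/nbhs_ballP; exists d => // s; rewrite -ball_normE /= => sd Ks.
by apply: (dP (- s)) => //; rewrite -ball_normE /= -normrN opprD !opprK.
Qed.

Lemma nabla_int_positive_linear T a b : closed T -> T a -> T b -> a < b ->
  positive_linear_on (ts_itv T a b) (fun f => nabla_int T f a b).
Proof.
move=> cT Ta Tb ab.
have cT' : closed (reflection T).
  by apply: (@preimage_closed _ _ -%R) => // x _; exact: opp_continuous.
have [||| lin mono] := @delta_int_positive_linear (reflection T) (- b) (- a) cT'.
- by rewrite /reflection /= opprK.
- by rewrite /reflection /= opprK.
- by rewrite ltrN2.
rewrite ts_itv_reflection in lin mono.
split=> [u v f g /cont_on_reflection cf /cont_on_reflection cg
        |f g /cont_on_reflection cf /cont_on_reflection cg fg].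
  by rewrite !nabla_int_reflection -lin.
by rewrite !nabla_int_reflection; apply: mono => // x; exact: fg.
Qed.

Lemma diamond_int_positive_linear alpha T a b : 0 <= alpha <= 1 ->
  closed T -> T a -> T b -> a < b ->
  positive_linear_on (ts_itv T a b) (fun f => diamond_int alpha T f a b).
Proof.
move=> /andP[al0 al1] cT Ta Tb ab.
have [dlin dmono] := delta_int_positive_linear cT Ta Tb ab.
have [nlin nmono] := nabla_int_positive_linear cT Ta Tb ab.
split=> [u v f g cf cg|f g cf cg fg]; rewrite /diamond_int.
  by rewrite dlin // nlin //; ring.
apply: lerD; apply: ler_wpM2l; rewrite ?subr_ge0 //; first exact: dmono.
exact: nmono.
Qed.

End Functionals.

Theorem theorem120 (R : realType) (T : set R) (a b alpha p q : R)
    (f g h : R -> R)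
    (hT : time_scale T) (Ta : T a) (Tb : T b) (ab : a < b)
    (halpha : 0 <= alpha <= 1)
    (hf : continuous_on_into (ts_itv T a b) `[0, +oo[ f)
    (hg : continuous_on_into (ts_itv T a b) `[0, +oo[ g)
    (hh : continuous_on_into (ts_itv T a b) `[0, +oo[ h)
    (hp : 1 < p) (hpq : p^-1 + q^-1 = 1)
    (hpos : 0 < diamond_int alpha T (fun x => h x * g x `^ q) a b) :
  diamond_int alpha T (fun x => h x * f x * g x) a b <=
    diamond_int alpha T (fun x => h x * f x `^ p) a b `^ p^-1 *
    diamond_int alpha T (fun x => h x * g x `^ q) a b `^ q^-1.
Proof.
have nonneg k : continuous_on_into (ts_itv T a b) `[0, +oo[ k ->
    cont_on (ts_itv T a b) k /\ forall x, ts_itv T a b x -> 0 <= k x.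
  move=> [ck k0]; split; first exact/subspace_continuousP.
  by move=> x /k0; rewrite /= in_itv /= andbT.
have [cf f0] := nonneg _ hf; have [cg g0] := nonneg _ hg.
have [ch h0] := nonneg _ hh.
have Ipos := diamond_int_positive_linear halpha hT.1 Ta Tb ab.
exact: (hoelder_positive_linear Ipos hp hpq cf cg ch f0 g0 h0 hpos).
Qed.
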